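(* Let $(X,d)$ be a nonempty compact metric space and let $\ell:X\times X\times\mathbb R\times\mathbb R\to\mathbb R$, $(x,y,u,v)\mapsto \ell(x,y,u,v)$, be a continuous function that is $C^1$ with respect to the last two variables $(u,v)$ and such that: (1) there is a constant $\kappa_u>0$ such that $0\ge \partial_u\ell(x,y,u,v)\ge-\kappa_u$ for all $(x,y,u,v)$; (2) there is a constant $\kappa_v>0$ such that $0\ge \partial_v\ell(x,y,u,v)\ge-\kappa_v$ for all $(x,y,u,v)$; (3) $\int_{X\times X}\big(\partial_u\ell(z,x,0,0)+\partial_v\ell(z,x,0,0)\big)\,d\mu(z,x)<0$ for all Mather measures $\mu$ of $\ell_0:=\ell(\cdot,\cdot,0,0)$. Let $c_0$ be the critical constant of $\ell_0$, let $\lambda_0>0$ satisfy $\lambda_0\max(\kappa_u,\kappa_v)<1$, and for $\lambda\in(0,\lambda_0)$ let $T_\lambda:C^0(X,\mathbb R)\to C^0(X,\mathbb R)$ be the associated implicit Lax-Oleinik operator. Then for every $\lambda\in(0,\lambda_0)$ the operator $T_\lambda$ has a fixed point $u_\lambda$. Moreover, if $S_\lambda$ denotes the set of fixed points of $T_\lambda$, then the family $(S_\lambda)_{\lambda\in(0,\lambda_0)}$ is made of equicontinuous and equibounded functions, i.e. $\bigcup_{\lambda\in(0,\lambda_0)}S_\lambda$ is an equicontinuous and uniformly bounded subset of $C^0(X,\mathbb R)$.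
   Context: ''$C^1$ with respect to the last two variables'' means that the partial derivatives $\partial_u\ell,\partial_v\ell$ exist everywhere and are continuous on $X\times X\times\mathbb R\times\mathbb R$. Critical constant: for a continuous $\ell_0:X\times X\to\mathbb R$, there is a unique constant $c_0\in\mathbb R$ for which there exists a continuous $u:X\to\mathbb R$ with $u(x)=\min_{y\in X}\{u(y)+\ell_0(y,x)\}+c_0$ for all $x\in X$ (known theorem); $c_0$ is the critical constant of $\ell_0$. Mather measure: a Borel probability measure $\mu$ on $X\times X$ is closed if its two marginals on $X$ coincide. A Mather measure of $\ell_0$ is a closed Borel probability measure $\mu$ on $X\times X$ with $\int_{X\times X}\ell_0\,d\mu=-c_0$. Implicit Lax-Oleinik operator: for $0<\lambda<\lambda_0$ and $\varphi\in C^0(X,\mathbb R)$, $T_\lambda\varphi$ is the unique function in $C^0(X,\mathbb R)$ such that for all $x\in X$ $$T_\lambda\varphi(x)=\min_{z\in X}\big\{\varphi(z)+\ell\big(z,x,\lambda\varphi(z),\lambda T_\lambda\varphi(x)\big)\big\}+c_0.$$ *)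

(* Defs.v *)
From HB Require Import structures.
From mathcomp Require Import all_boot all_order all_algebra.
From mathcomp Require Import all_classical all_reals all_analysis.

Set Implicit Arguments.
Unset Strict Implicit.
Unset Printing Implicit Defensive.

Import Order.TTheory GRing.Theory Num.Theory.
Import numFieldNormedType.Exports.

Local Open Scope classical_set_scope.
Local Open Scope ring_scope.

(* A nonempty metric space: measurable types in the library carry a
   distinguished point, which is how nonemptiness is expressed. *)
#[short(type="pmetricType")]
HB.structure Definition PointedMetric (R : numDomainType) :=
  {M of Metric R M & Pointed M}.

Section Definitions.
Context {R : realType} {X : pmetricType R}.

Local Notation C0 := (continuousType X R).

(* A point p = (x, y, u, v) is (((x, y), u), v). *)
Implicit Types (l : X * X * R * R -> R).

Definition partial_u l (p : X * X * R * R) : R :=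
  'D_1 (fun u : R => l (p.1.1, u, p.2)) p.1.2.

Definition partial_v l (p : X * X * R * R) : R :=
  'D_1 (fun v : R => l (p.1, v)) p.2.

Definition C1_last_two l : Prop :=
  [/\ forall p, derivable (fun u : R => l (p.1.1, u, p.2)) p.1.2 1,
      forall p, derivable (fun v : R => l (p.1, v)) p.2 1,
      continuous (partial_u l) & continuous (partial_v l)].

Definition is_min (f : X -> R) (m : R) : Prop :=
  range f m /\ lbound (range f) m.

(* The constant with this property is unique on a compact space. *)
Definition is_critical_constant (l0 : X * X -> R) (c0 : R) : Prop :=
  exists u : C0, forall x,
    exists2 m, is_min (fun y => u y + l0 (y, x)) m & u x = m + c0.

Definition borel_probability2 :=
  probability (g_sigma_algebraType (@open (X * X)%type)) R.

Definition closed_measure (mu : borel_probability2) : Prop :=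
  forall A : set (g_sigma_algebraType (@open X)), measurable A ->
    mu (fst @^-1` A) = mu (snd @^-1` A).

Definition mather_measure (l0 : X * X -> R) (c0 : R)
    (mu : borel_probability2) : Prop :=
  closed_measure mu /\ (\int[mu]_p (l0 p)%:E = (- c0)%:E)%E.

(* [T phi] occurs on both sides; the equation determines it when
   [lam * kappa < 1] for a lower bound [- kappa] of [partial_v l]. *)
Definition is_implicit_lax_oleinik l (c0 lam : R) (T : C0 -> C0) : Prop :=
  forall (phi : C0) (x : X), exists2 m,
    is_min (fun z => phi z + l (z, x, lam * phi z, lam * T phi x)) m &
    T phi x = m + c0.

Definition fixed_points (T : C0 -> C0) : set C0 := [set u | T u = u].

End Definitions.
Arguments borel_probability2 {R} X.

(* Main.v *)
Require Import Defs.
From HB Require Import structures.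
From mathcomp Require Import all_boot all_order all_algebra.
From mathcomp Require Import all_classical all_reals all_analysis.
From mathcomp Require Import measurable_realfun lra.

Set Implicit Arguments.
Unset Strict Implicit.
Unset Printing Implicit Defensive.

Import Order.TTheory GRing.Theory Num.Theory.
Import numFieldNormedType.Exports.

Local Open Scope classical_set_scope.
Local Open Scope ring_scope.

(* The operators T_lambda are monotone. If u0 solves the critical equation and
   B bounds |u0|, then u0 + B >= 0 is a supersolution and u0 - B <= 0 a
   subsolution, because l is nonincreasing in (u, v); iterating T_lambda from
   u0 + B gives a fixed point.

   For bounds uniform in lambda, the point is that a fixed point u changes
   sign. Follow a backward calibrated orbit, of u0 if u > 0 and of u if u < 0,
   and let mu be a closed measure obtained as a limit of its empirical
   measures. Along the orbit w(z) <= w(x), with w = u0 - u or w = u - u0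
   respectively; since mu is closed, w(z) = w(x) holds mu-almost everywhere.
   This forces mu to be a Mather measure with l(z, x, lambda u(z), lambda
   u(x)) = l(z, x, 0, 0) almost everywhere, so by monotonicity l is flat
   between 0 and these values, and both partial derivatives vanish at 0 on a
   set of full measure, against (3). Once u takes both signs, comparing any
   point with a point of the opposite sign bounds |u|, and a bound on u gives
   a modulus of continuity through the implicit equation. *)

(** * Borel measures from finitely additive contents *)

Section content_measure.
Context {R : realType} {Y : ptopologicalType}.
Hypotheses (normalY : normal_space Y) (compactY : compact [set: Y]).
Variable nu : set Y -> R.
Hypotheses (nu_ge0 : forall A, 0 <= nu A) (nuT : nu setT = 1).
Hypothesis nuU : forall A B, A `&` B = set0 -> nu (A `|` B) = nu A + nu B.

Lemma le_content A B : A `<=` B -> nu A <= nu B.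
Proof.
by move=> /setDUK <-; rewrite nuU ?lerDl ?setDIK.
Qed.

Let nu0 : nu set0 = 0.
Proof.
have := nuU (set0I (@set0 Y)); rewrite setU0 => /eqP.
by rewrite addrC -subr_eq subrr eq_sym => /eqP.
Qed.

Let nuU_le A B : nu (A `|` B) <= nu A + nu B.
Proof.
have -> : A `|` B = A `|` (B `\` A).
  apply/seteqP; split=> [y [Ay|By]|y [Ay|[By _]]]; [by left| |by left|by right].
  by have [Ay|nAy] := pselect (A y); [left|right].
by rewrite nuU ?setDIK// lerD2l; apply: le_content; exact: subDsetl.
Qed.

(* The finitely additive [nu] is only trusted on closed sets: regularizing it
   from inside on open sets, then from outside, restores countable
   subadditivity by compactness. *)
Definition inner_content (U : set Y) : \bar R :=
  ereal_sup [set (nu K)%:E | K in [set K | closed K /\ K `<=` U]].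

Local Notation inner := inner_content.

Local Open Scope ereal_scope.

Let inner_ub K U : closed K -> K `<=` U -> (nu K)%:E <= inner U.
Proof. by move=> cK KU; apply: ereal_sup_ubound; exists K. Qed.

Let inner_le U (x : \bar R) :
  (forall K, closed K -> K `<=` U -> (nu K)%:E <= x) -> inner U <= x.
Proof. by move=> h; apply: ge_ereal_sup => _ [K [cK KU] <-]; exact: h. Qed.

Let inner_ge0 U : 0 <= inner U.
Proof. by apply: le_trans (inner_ub closed0 (@sub0set _ _)); rewrite lee_fin. Qed.

Let inner_le1 U : inner U <= 1.
Proof. by apply: inner_le => K _ _; rewrite lee_fin -nuT le_content. Qed.

Let inner_fin U : inner U \is a fin_num.
Proof.
by rewrite ge0_fin_numE// (le_lt_trans (inner_le1 U)) ?ltry.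
Qed.

Let inner_mono U V : U `<=` V -> inner U <= inner V.
Proof.
by move=> UV; apply: inner_le => K cK KU; apply: inner_ub => //; exact: subset_trans UV.
Qed.

(** For [K] closed in the union, [K \ V] and [K \ U] are disjoint closed sets. Normality separates
    them by disjoint open [P] and [Q]; then [K \ Q] lies in [U], [K \ P] lies in [V], and together
    they cover [K]. *)
Let innerU_le U V : open U -> open V -> inner (U `|` V) <= inner U + inner V.
Proof.
move=> oU oV; apply: inner_le => K cK KUV.
have cKU : closed (K `\` U) by rewrite setDE; apply: closedI => //; exact: open_closedC.
have cKV : closed (K `\` V) by rewrite setDE; apply: closedI => //; exact: open_closedC.
have KUV0 : (K `\` V) `&` (K `\` U) = set0.
  by apply/seteqP; split => // y [[Ky nV] [_ nU]]; have [] := KUV _ Ky.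
have [P [Q [oP oQ KP KQ PQ0]]] :=
  (@normal_openP R Y).1 normalY _ _ cKV cKU KUV0.
have KE : K `<=` (K `\` Q) `|` (K `\` P).
  move=> y Ky; have [Qy|nQy] := pselect (Q y); [right|by left].
  split=> // Py; suff : (P `&` Q) y by rewrite PQ0.
  by split.
apply: (@le_trans _ _ ((nu (K `\` Q))%:E + (nu (K `\` P))%:E)).
  by rewrite -EFinD lee_fin (le_trans (le_content KE))//.
apply: leeD; apply: inner_ub.
- by rewrite setDE; apply: closedI => //; exact: open_closedC.
- by move=> y [Ky nQy]; apply: contrapT => nUy; apply: nQy; apply: KQ; split.
- by rewrite setDE; apply: closedI => //; exact: open_closedC.
- by move=> y [Ky nPy]; apply: contrapT => nVy; apply: nPy; apply: KP; split.
Qed.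

Let inner0 : inner set0 = 0.
Proof.
apply/eqP; rewrite eq_le inner_ge0 andbT; apply: inner_le => K _.
by rewrite subset0 => ->; rewrite nu0.
Qed.

(** A closed subset of the union is compact, so finitely many of the [F n] already cover it and
    finite subadditivity applies. *)
Let inner_bigcup (F : (set Y)^nat) : (forall n, open (F n)) ->
  inner (\bigcup_n F n) <= \sum_(n <oo) inner (F n).
Proof.
move=> oF; apply: inner_le => K cK KF.
have cpK : compact K by apply: (subclosed_compact cK compactY).
move: cpK; rewrite compact_cover => /(_ nat setT F (fun n _ => oF n)) [].
  by move=> y Ky; have [n _ Fn] := KF _ Ky; exists n.
move=> D _ KD.
(* One more than the largest index of the finite subcover. *)
pose N := (\max_(i <- finmap.enum_fset D) i).+1%N.
have {}KD : K `<=` \big[setU/set0]_(i < N) F i.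
  move=> y /KD[i iD Fiy]; rewrite -bigcup_mkord; exists i => //=.
  rewrite /N ltnS; exact: (@leq_bigmax_seq _ _ xpredT id).
apply: (@le_trans _ _ (\sum_(i < N) inner (F i))); last first.
  have := @nneseries_lim_ge R (fun n => inner (F n)) xpredT 0 N.
  by rewrite big_mkord; apply => n _ _; exact: inner_ge0.
apply: (le_trans (inner_ub cK KD)).
suff H n : open (\big[setU/set0]_(i < n) F i) /\
   inner (\big[setU/set0]_(i < n) F i) <= \sum_(i < n) inner (F i).
  by have [] := H N.
elim: n => [|n [IHo IH]]; first by rewrite !big_ord0 inner0; split => //; exact: open0.
rewrite !big_ord_recr/=; split; first exact: openU.
by apply: (le_trans (innerU_le _ _)) => //; exact: leeD2r.
Qed.

Definition outer_content (A : set Y) : \bar R :=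
  ereal_inf [set inner U | U in [set U | open U /\ A `<=` U]].

Local Notation outer := outer_content.

Let outer_lb A U : open U -> A `<=` U -> outer A <= inner U.
Proof. by move=> oU AU; apply: ereal_inf_lbound; exists U. Qed.

Let outer_ge A (x : \bar R) :
  (forall U, open U -> A `<=` U -> x <= inner U) -> x <= outer A.
Proof. by move=> h; apply: le_ereal_inf_tmp => _ [U [oU AU] <-]; exact: h. Qed.

Let outer_open U : open U -> outer U = inner U.
Proof.
move=> oU; apply/eqP; rewrite eq_le outer_lb//=.
by apply: outer_ge => V oV UV; exact: inner_mono.
Qed.

Let outer0 : outer set0 = 0.
Proof. by rewrite outer_open// ?inner0//; exact: open0. Qed.

Let outer_content_ge0 A : 0 <= outer A.
Proof. by apply: outer_ge => *; exact: inner_ge0. Qed.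

Let le_outer : {homo outer : A B / A `<=` B >-> A <= B}.
Proof.
by move=> A B AB; apply: outer_ge => U oU BU; apply: outer_lb => //; exact: subset_trans BU.
Qed.

Let outer_fin A : outer A \is a fin_num.
Proof.
rewrite ge0_fin_numE// (@le_lt_trans _ _ (inner setT)) ?outer_lb//; first exact: openT.
by rewrite (le_lt_trans (inner_le1 _)) ?ltry.
Qed.

Let outer_sigma_subadditive : sigma_subadditive outer.
Proof.
move=> F; apply/lee_addgt0Pr => e e0.
have H n : exists U, [/\ open U, F n `<=` U &
    inner U <= outer (F n) + (e / (2 ^ n.+1)%:R)%:E].
  have e0n : (0 < e / (2 ^ n.+1)%:R)%R by rewrite divr_gt0// ltr0n expn_gt0.
  have [_ [U [oU FU] <-] /ltW h] := lb_ereal_inf_adherent e0n (outer_fin (F n)).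
  by exists U.
have [U HU] := choice H.
apply: (@le_trans _ _ (inner (\bigcup_n U n))).
  apply: outer_lb; first by apply: bigcup_open => n _; have [] := HU n.
  by apply: subset_bigcup => n _; have [] := HU n.
apply: (le_trans (inner_bigcup _)); first by move=> n; have [] := HU n.
apply: le_trans (epsilon_trick xpredT _ (ltW e0)) => //.
by apply: lee_nneseries => [n _|n _]//; have [] := HU n.
Qed.

HB.instance Definition _ := isOuterMeasure.Build R Y outer_content
  outer0 outer_content_ge0 le_outer outer_sigma_subadditive.

(** The set [A] may be replaced by an open [V] containing it. Choose [K] closed in [V] and [G] of
    almost full content: any closed [L] avoiding [K] inside [V] satisfies
    [nu K + nu L = nu (K + L) <= inner V], and [V \ K] is an open set containing [V \ G]. *)
Let open_caratheodory G : open G -> outer_content.-caratheodory G.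
Proof.
move=> oG; apply: le_caratheodory_measurable => A.
apply: outer_ge => V oV AV.
apply: (@le_trans _ _ (outer (V `&` G) + outer (V `&` ~` G))).
  by apply: leeD; apply: le_outer; exact: setSI.
rewrite outer_open; last exact: openI.
apply/lee_addgt0Pr => e e0.
have [_ [K [cK KVG] <-] /ltW] := ub_ereal_sup_adherent e0 (inner_fin (V `&` G)).
rewrite -/(inner _) leeBlDr// => h1.
apply: (le_trans (leeD2r _ h1)).
rewrite addeAC leeD2r//.
rewrite -leeBrDl//.
apply: (@le_trans _ _ (inner (V `\` K))).
  apply: outer_lb; first by rewrite setDE; apply: openI => //; exact: closed_openC.
  by move=> y [Vy nGy]; split=> // /KVG[].
apply: inner_le => L cL LVK; rewrite leeBrDl// -EFinD -nuU.
  apply: inner_ub; first exact: closedU.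
  by move=> y [/KVG[]|/LVK[]].
by apply/seteqP; split => // y [Ky /LVK[]].
Qed.

Let borel_caratheodory (A : set (g_sigma_algebraType (@open Y))) :
  measurable A -> outer_content.-cara.-measurable (A : set (caratheodory_type outer_content)).
Proof.
apply: smallest_sub; first exact: sigma_algebra_measurable.
by move=> G oG; exact: open_caratheodory.
Qed.

(** The outer measure is countably additive on Caratheodory sets; it is retyped here on the Borel
    sets, which are among them. *)
Definition content_measure (A : set (g_sigma_algebraType (@open Y))) : \bar R :=
  outer_content A.

Let content_measure_sigma_additive : semi_sigma_additive content_measure.
Proof.
move=> F mF tF mUF; apply: caratheodory_measure_sigma_additive => //.
- by move=> n; exact: borel_caratheodory.
- exact: borel_caratheodory.
Qed.

HB.instance Definition _ := isMeasure.Build _ _ _ content_measure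
  outer0 outer_content_ge0 content_measure_sigma_additive.

Let content_measureT : content_measure setT = 1.
Proof.
rewrite /content_measure outer_open; last exact: openT.
by apply/eqP; rewrite eq_le inner_le1/= -nuT inner_ub//; exact: closedT.
Qed.

HB.instance Definition _ :=
  Measure_isProbability.Build _ _ _ content_measure content_measureT.

(** The formula on open sets lets the measure inherit the symmetries of [nu]; the inequality on
    closed sets carries over full mass, since a closed set with [nu K = 1] gets measure one. *)
Lemma exists_content_measure :
  exists mu : probability (g_sigma_algebraType (@open Y)) R,
    (forall U, open U -> mu U = inner_content U) /\
    (forall K, closed K -> (nu K)%:E <= mu K).
Proof.
exists content_measure; split=> [U oU|K cK]; first exact: outer_open.
apply: outer_ge => U oU KU; exact: inner_ub.
Qed.

End content_measure.

(** * Closed measures carried by backward orbits *)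

Lemma ultra_fmap (S T : Type) (f : S -> T) (F : set_system S) :
  UltraFilter F -> UltraFilter (f @ F).
Proof.
move=> UF; split; first exact: fmap_proper_filter.
move=> G GP FG; apply/seteqP; split=> // A GA.
have [//|FA] := in_ultra_setVsetC (f @^-1` A) UF.
have GAC : G (~` A) by exact: FG.
by have [t []] := filter_ex (filterI GA GAC).
Qed.

(* The ultrafilter limit makes the frequency finitely additive on all subsets
   at once, at the price of countable additivity. *)
Lemma exists_limit_frequency (R : realType) (Y : Type) (y : nat -> Y) :
  exists nu : set Y -> R,
    [/\ forall A, 0 <= nu A,
        nu setT = 1,
        forall A B, A `&` B = set0 -> nu (A `|` B) = nu A + nu B,
        forall A, (forall n, A (y n)) -> nu A = 1 &
        forall A B, (forall n, A (y n) <-> B (y n.+1)) -> nu A = nu B].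
Proof.
have [U [UU ooU]] := ultraFilterLemma (eventually_filter : ProperFilter \oo).
pose s (A : set Y) n : R := \sum_(k < n) \1_A (y k).
pose freq (A : set Y) n : R := s A n.+1 / n.+1%:R.
have s_ge0 A n : 0 <= s A n by apply: sumr_ge0 => k _; rewrite indicE.
have s_le A n : s A n <= n%:R.
  rewrite -[n in leRHS]card_ord -sum1_card natr_sum; apply: ler_sum => k _.
  by rewrite indicE; case: (_ \in _).
have freq01 A n : freq A n \in `[0, 1].
  rewrite in_itv/=; apply/andP; split; first by rewrite divr_ge0.
  by rewrite ler_pdivrMr ?ltr0Sn// mul1r.
have cv A : exists r : R, freq A @ U --> r.
  have := @segment_compact R 0 1; rewrite compact_ultra.
  move=> /(_ (freq A @ U) (ultra_fmap _ _)) [|r [_ fr]]; last by exists r.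
  by apply: nearW => n; exact: freq01.
have [nu nuP] := choice cv.
have nu_eq A (r : R) : freq A @ U --> r -> nu A = r.
  by move=> h; apply: cvg_unique (nuP A) h.
have nu_all A : (forall n, A (y n)) -> nu A = 1.
  move=> Ay; apply: nu_eq; rewrite (_ : freq A = cst 1); first exact: cvg_cst.
  apply/funext => n; rewrite /freq /s (eq_bigr (fun=> 1)); last first.
    by move=> k _; rewrite indicE mem_set.
  by rewrite sumr_const card_ord divff// pnatr_eq0.
exists nu; split=> //.
- move=> A; apply: (cvgr_to_ge (nuP A)).
  by apply: nearW => n; have := freq01 A n; rewrite in_itv/= => /andP[].
- exact: nu_all.
- move=> A B AB; apply: nu_eq.
  rewrite (_ : freq (A `|` B) = fun n => freq A n + freq B n).
    exact: cvgD.
  apply/funext => n; rewrite /freq -mulrDl; congr (_ / _).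
  rewrite /s -big_split/=; apply: eq_bigr => k _.
  rewrite !indicE in_setU; case: (boolP (y k \in A)) => [/set_mem yA|_]; last first.
    by rewrite add0r.
  case: (boolP (y k \in B)) => [/set_mem yB|_]; last by rewrite addr0.
  by have : (A `&` B) (y k) by []; rewrite AB.
- move=> A B AB; apply: nu_eq.
  (* The two counts differ by a shift of one index, so only the boundary terms survive. *)
  have sAB n : s A n = s B n + (\1_B (y n) - \1_B (y 0%N)).
    elim: n => [|n IH]; first by rewrite /s !big_ord0 subrr addr0.
    rewrite /s big_ord_recr/= -/(s A n) IH big_ord_recr/= -/(s B n).
    have -> : \1_A (y n) = \1_B (y n.+1) :> R.
      rewrite !indicE; congr ((nat_of_bool _)%:R); apply/idP/idP => /set_mem h; apply/mem_set.
        exact/AB.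
      exact/AB.
    lra.
  rewrite (_ : freq A = fun n => freq B n + (\1_B (y n.+1) - \1_B (y 0%N)) / n.+1%:R); last first.
    by apply/funext => n; rewrite /freq sAB mulrDl.
  rewrite -[nu B]addr0; apply: cvgD => //.
  (* The ultrafilter refines [\oo], so ordinary convergence of the boundary term is enough. *)
  suff h : (\1_B (y n.+1) - \1_B (y 0%N)) / n.+1%:R @[n --> \oo] --> (0 : R).
    exact: cvg_trans (cvg_app _ ooU) h.
  apply/norm_cvg0P.
  apply: (@squeeze_cvgr _ _ _ _ (cst 0) (@harmonic R)); last 2 first.
  - exact: cvg_cst.
  - exact: cvg_harmonic.
  near=> n; rewrite normr_ge0/= normrM normfV normr_nat.
  rewrite ler_piMl// ler_norml !indicE.
  by case: (_ \in _); case: (_ \in _); rewrite /= ?mulr1n ?mulr0n; apply/andP; split; lra.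
Unshelve. all: by end_near. Qed.

HB.instance Definition _ (S T : ptopologicalType) := Pointed.on (S * T)%type.

(** * Continuous functions and Borel measures *)

Section borel.
Context {R : realType} {Y : ptopologicalType}.
Local Notation borel := (g_sigma_algebraType (@open Y)).

Lemma borel_open (A : set borel) : open (A : set Y) -> measurable A.
Proof. exact: sub_sigma_algebra. Qed.

Lemma borel_closed (A : set borel) : closed (A : set Y) -> measurable A.
Proof.
move=> cA; rewrite -(setCK A); apply: measurableC; apply: borel_open.
exact: closed_openC.
Qed.

Lemma continuous_borel_measurable (f : Y -> R) :
  continuous f -> measurable_fun setT (f : borel -> R).
Proof.
move=> /continuousP cf; apply: (measurability _ (RGenOpens.measurableE R)).
move=> _ [_ [a [b ->] <-]]; rewrite setTI; apply: borel_open.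
exact/cf/interval_open.
Qed.

Lemma continuous_borel_map (Z : ptopologicalType) (f : Y -> Z) :
  continuous f ->
  measurable_fun setT (f : borel -> g_sigma_algebraType (@open Z)).
Proof.
move=> /continuousP cf; apply: (@measurability _ _ borel (g_sigma_algebraType (@open Z))
  setT f (@open Z) erefl).
by move=> _ [A oA <-]; rewrite setTI; apply: borel_open; exact: cf.
Qed.

Lemma continuous_borel_integrable (P : probability borel R) (f : Y -> R) :
  compact [set: Y] -> continuous f -> P.-integrable setT (EFin \o f).
Proof.
move=> cY cf; apply: measurable_bounded_integrable => //.
- exact: le_lt_trans (probability_le1 P measurableT) (ltry 1).
- exact: continuous_borel_measurable.
- have /compact_bounded [M [Mr h]] : compact (f @` setT).
    by apply: continuous_compact => //; exact: continuous_subspaceT.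
  exists M; split=> // e Me y _ /=.
  by apply: (h e Me); exists y.
Qed.

Lemma borel_measure_unique (m1 m2 : {measure set borel -> \bar R}) :
  (m1 setT < +oo)%E -> (forall A, open A -> m1 A = m2 A) ->
  forall A, measurable A -> m1 A = m2 A.
Proof.
move=> m1T m12; apply: (@measure_unique _ R borel (@open Y) (fun=> setT)) => //.
- exact: openI.
- by move=> _; exact: openT.
- exact: bigcup_const.
Qed.

End borel.

(** * From limit frequencies to closed measures *)

Section closed_measures.
Context {R : realType} {X : pmetricType R}.
Hypothesis compactX : compact [set: X].

Let compactXX : compact [set: X * X].
Proof. by rewrite -setXTT; exact: compact_setX. Qed.

Let fst_cont : continuous (@fst X X).
Proof. by move=> p; exact: cvg_fst. Qed.

Let snd_cont : continuous (@snd X X).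
Proof. by move=> p; exact: cvg_snd. Qed.

(* [x n.+1] precedes [x n]: the sequence is a backward orbit, and the pairs
   follow the (z, x) convention of the cost. *)
Lemma exists_closed_measure (x : nat -> X) :
  exists mu : borel_probability2 X, closed_measure mu /\
    forall K : set (X * X), closed K -> (forall n, K (x n.+1, x n)) ->
      mu K = 1%E.
Proof.
have [nu [nu_ge0 nuT nuU nu1 nuS]] :=
  exists_limit_frequency R (fun n => (x n.+1, x n)).
have [mu [muU muK]] := @exists_content_measure R (X * X)%type
  (@pseudometric_normal R (X * X)%type) compactXX nu nu_ge0 nuT nuU.
(* The first coordinate of each pair is the second coordinate of the next pair. *)
have shift (B : set X) : nu (fst @^-1` B) = nu (snd @^-1` B) by apply: nuS.
have closed_img (f : X * X -> X) K : continuous f -> closed K -> closed (f @` K).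
  move=> cf cK; apply: compact_closed; first exact: metric_hausdorff.
  apply: continuous_compact; first exact: continuous_subspaceT.
  exact: subclosed_compact cK compactXX _.
have le_img (f g : X * X -> X) (A : set X) : continuous f -> continuous g ->
    (forall B : set X, nu (f @^-1` B) = nu (g @^-1` B)) ->
    (inner_content nu (f @^-1` A) <= inner_content nu (g @^-1` A))%E.
  move=> cf cg fg; apply: ge_ereal_sup => _ [K [cK KA] <-].
  apply: (@le_trans _ _ (nu (g @^-1` (f @` K)))%:E).
    by rewrite lee_fin -fg le_content//; exact: preimage_image.
  apply: ereal_sup_ubound; exists (g @^-1` (f @` K)) => //; split.
    by apply: (preimage_closed (fun p _ => cg p)); exact: closed_img.
  by move=> p [q /KA qA /= qp]; rewrite /= -qp.
exists mu; split; last first.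
  move=> K cK Kx; apply/eqP; rewrite eq_le probability_le1/=; last exact: borel_closed.
  by have := muK K cK; rewrite nu1.
have muE (A : set X) : open A -> mu (fst @^-1` A) = mu (snd @^-1` A).
  move=> oA; rewrite !muU; last 2 first.
  - by move/continuousP : snd_cont; exact.
  - by move/continuousP : fst_cont; exact.
  by apply/eqP; rewrite eq_le !le_img.
move=> A mA.
apply: (borel_measure_unique
  (m1 := pushforward mu (fst : g_sigma_algebraType (@open (X * X)%type) ->
     g_sigma_algebraType (@open X)))
  (m2 := pushforward mu (snd : g_sigma_algebraType (@open (X * X)%type) ->
     g_sigma_algebraType (@open X))) _ muE mA).
- exact: continuous_borel_map.
- exact: continuous_borel_map.
- by move=> mf; exact: le_lt_trans (probability_le1 mu measurableT) (ltry 1).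
Qed.

End closed_measures.

(** * Measures carried by a closed set *)

Section full_measure.
Context {R : realType} {Y : ptopologicalType}.
Variable P : probability (g_sigma_algebraType (@open Y)) R.
Variable K : set Y.
Hypotheses (closedK : closed K) (PK : P K = 1%E).

Let ae_K : {ae P, forall y, K y}.
Proof.
have mK : measurable (K : set (g_sigma_algebraType (@open Y))) by exact: borel_closed.
exists (~` K); split; [exact: measurableC| |by move=> p].
by rewrite [LHS]probability_setC// PK subee.
Qed.

Lemma full_measure_eq_integral (f g : Y -> R) :
  continuous f -> continuous g -> (forall y, K y -> f y = g y) ->
  (\int[P]_y (f y)%:E = \int[P]_y (g y)%:E)%E.
Proof.
move=> cf cg fg; apply: ae_eq_integral => //.
- by apply/measurable_EFinP; exact: continuous_borel_measurable.
- by apply/measurable_EFinP; exact: continuous_borel_measurable.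
- apply: (@filterS _ _ (ae_filter_ringOfSetsType P) _ _ _ ae_K) => y /fg + _.
  by move=> ->.
Qed.

(** On [K] the function equals its absolute value, so [|g|] also integrates to zero and [g] vanishes
    almost everywhere. *)
Lemma full_measure_zero (g : Y -> R) :
  continuous g -> (forall y, K y -> 0 <= g y) ->
  (\int[P]_y (g y)%:E = 0)%E -> P (K `&` [set y | g y = 0]) = 1%E.
Proof.
move=> cg g0 ig0.
have : (\int[P]_y `|(g y)%:E| = 0)%E.
  rewrite -ig0; under eq_integral do rewrite abse_EFin.
  apply: full_measure_eq_integral => //.
    by move=> y; apply: cvg_norm; exact: cg.
  by move=> y /g0 gy; rewrite ger0_norm.
move/ae_eq_integral_abs => /(_ measurableT) h.
have /h{h} : measurable_fun [set: g_sigma_algebraType (@open Y)]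
    (fun y => (g y)%:E).
  by apply/measurable_EFinP; exact: continuous_borel_measurable.
move=> h.
have [N [mN PN0 subN]] : {ae P, forall y, K y /\ g y = 0}.
  apply: (@filterS2 _ _ (ae_filter_ringOfSetsType P) _ _ _ _ ae_K h) => y Ky.
  by move=> /(_ I) [gy].
have cKg : closed (K `&` [set y | g y = 0]).
  apply: closedI => //.
  rewrite (_ : [set y | g y = 0] = g @^-1` [set 0])//.
  by apply: (preimage_closed (fun y _ => cg y)); exact: closed_eq.
apply/eqP; rewrite eq_le probability_le1/=; last exact: borel_closed.
rewrite -[leLHS](@probability_setT _ _ _ P) -(setvU N) measureU ?setICl//; last exact: measurableC.
rewrite [X in (_ + X)%E]PN0 adde0; apply: le_measure; rewrite ?inE.
- exact: measurableC.
- exact: borel_closed.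
- by move=> y Ny; apply: contrapT => h'; apply: Ny; exact: subN.
Qed.

End full_measure.

(** * Coboundaries integrate to zero against closed measures *)

Section closed_measure_integration.
Context {R : realType} {X : pmetricType R}.
Hypothesis compactX : compact [set: X].
Variable mu : borel_probability2 X.

Let compactXX : compact [set: X * X].
Proof. by rewrite -setXTT; exact: compact_setX. Qed.

Hypothesis closed_mu : closed_measure mu.

Lemma closed_measure_integral (w : X -> R) : continuous w ->
  (\int[mu]_p (w p.1)%:E = \int[mu]_p (w p.2)%:E)%E.
Proof.
move=> cw.
have push (f : X * X -> X) : continuous f ->
    (\int[mu]_p (w (f p))%:E = \int[pushforward mu
      (f : g_sigma_algebraType (@open (X * X)%type) ->
           g_sigma_algebraType (@open X))]_x (w x)%:E)%E.
  move=> cf; rewrite (@integral_pushforward _ _ _ _ R _ _ mu setT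
    (EFin \o (w : g_sigma_algebraType (@open X) -> R)))//.
  - exact: continuous_borel_map.
  - by apply/measurable_EFinP; exact: continuous_borel_measurable.
  - rewrite preimage_setT.
    apply: (@continuous_borel_integrable R (X * X)%type mu (w \o f)) => //.
    by move=> p; apply: continuous_comp; [exact: cf|exact: cw].
rewrite push; last by move=> p; exact: cvg_fst.
rewrite push; last by move=> p; exact: cvg_snd.
apply: (@eq_measure_integral _ (g_sigma_algebraType (@open X)) R setT
  (pushforward mu (snd : g_sigma_algebraType (@open (X * X)%type) ->
     g_sigma_algebraType (@open X)))
  (pushforward mu (fst : g_sigma_algebraType (@open (X * X)%type) ->
     g_sigma_algebraType (@open X)))).
- by apply: continuous_borel_map => p; exact: cvg_snd.
- by apply: continuous_borel_map => p; exact: cvg_fst.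
- by move=> mf mg A mA _; exact: closed_mu.
Qed.

Lemma closed_measure_integralB (w : X -> R) : continuous w ->
  (\int[mu]_p (w p.2 - w p.1)%:E = 0)%E.
Proof.
move=> cw.
have int1 : mu.-integrable setT (EFin \o (fun p : X * X => w p.1)).
  apply: (@continuous_borel_integrable R (X * X)%type mu (w \o fst)) => // p.
  by apply: continuous_comp; [exact: cvg_fst|exact: cw].
have int2 : mu.-integrable setT (EFin \o (fun p : X * X => w p.2)).
  apply: (@continuous_borel_integrable R (X * X)%type mu (w \o snd)) => // p.
  by apply: continuous_comp; [exact: cvg_snd|exact: cw].
under eq_integral do rewrite EFinB.
rewrite integralB_EFin// closed_measure_integral// subee//.
exact: integrable_fin_num.
Qed.

End closed_measure_integration.

(** * Monotonicity and flatness of the cost *)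

Lemma cvg_to_pair {I : Type} {F : set_system I} {FF : Filter F}
    {S T : topologicalType} (f : I -> S) (g : I -> T) (a : S) (b : T) :
  f @ F --> a -> g @ F --> b -> (f i, g i) @[i --> F] --> (a, b).
Proof. by move=> fa gb; exact: cvg_pair. Qed.

Lemma continuous_pair {S U V : topologicalType} (f : S -> U) (g : S -> V) x :
  {for x, continuous f} -> {for x, continuous g} ->
  {for x, continuous (fun t => (f t, g t))}.
Proof. by move=> cf cg; exact: cvg_to_pair. Qed.

Section one_variable.
Context {R : realType}.
Variable f : R -> R.
Hypothesis df : forall x, derivable f x 1.

Let f_cont : continuous f.
Proof. by move=> x; apply/differentiable_continuous/derivable1_diffP. Qed.

Lemma derivable_MVT a b : a <= b ->
  exists2 c, a <= c <= b & f b - f a = 'D_1 f c * (b - a).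
Proof.
move=> ab; have [//|||c] := @MVT_segment R f ('D_1 f) a b.
- by move=> x _; exact/derivableP.
- exact: continuous_subspaceT.
- by rewrite in_itv/= => cab fab; exists c.
Qed.

(** The point [x] may be an endpoint of the flat interval. A nonzero derivative would stay nonzero
    near [x], while the mean value theorem on a small flat interval touching [x] produces a zero of
    it. *)
Lemma derive_flat a b x : {for x, continuous ('D_1 f)} ->
  a < b -> a <= x <= b -> (forall y, a <= y <= b -> f y = f x) -> 'D_1 f x = 0.
Proof.
move=> cD ab /andP[ax xb] fx; apply/eqP; apply: contraT => Dx0.
have : \forall y \near x, 'D_1 f y != 0.
  exact: (@cvgr_neq0 R R^o R (nbhs x) _ ('D_1 f) ('D_1 f x) cD Dx0).
move=> /nbhs_ballP[e /= e0 De].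
(* The interval is taken to the right of [x], or to its left when [x] is the right endpoint. *)
have [a' [b' [a'b' aa' bb' sub]]] : exists a' b', [/\ a' < b', a <= a', b' <= b &
    forall y, a' <= y <= b' -> `|x - y| < e].
  have [xltb|bx] := ltP x b.
    exists x, (Num.min b (x + e / 2)); split => //.
    - by rewrite lt_min xltb ltrDl divr_gt0.
    - by rewrite ge_min lexx.
    - move=> y; rewrite le_min => /and3P[xy _ ye].
      by rewrite ltr_norml; lra.
  exists (Num.max a (x - e / 2)), x; split => //.
  - by rewrite gt_max (lt_le_trans ab bx)/= ltrBlDr ltrDl divr_gt0.
  - by rewrite le_max lexx.
  - move=> y; rewrite ge_max => /andP[/andP[_ ye] yx].
    by rewrite ltr_norml; lra.
have [c /[dup] cab /sub/De Dc0] := derivable_MVT (ltW a'b').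
rewrite !fx; [|lra|lra]; rewrite subrr => /esym/eqP.
by rewrite mulf_eq0 (negbTE Dc0)/= subr_eq0 gt_eqF.
Qed.

End one_variable.

Section cost.
Context {R : realType} {X : pmetricType R}.
Variable l : X * X * R * R -> R.
Hypotheses (l_cont : continuous l) (l_C1 : C1_last_two l).
Variables kappa_u kappa_v : R.
Hypothesis hu : forall p, - kappa_u <= partial_u l p <= 0.
Hypothesis hv : forall p, - kappa_v <= partial_v l p <= 0.

Let derivable_u q v u : derivable (fun u => l (q, u, v)) u 1.
Proof. by have [h _ _ _] := l_C1; exact: (h (q, u, v)). Qed.

Let derivable_v q u v : derivable (fun v => l (q, u, v)) v 1.
Proof. by have [_ h _ _] := l_C1; exact: (h (q, u, v)). Qed.

Lemma cost_lipschitz_u q v a b : a <= b ->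
  l (q, a, v) - kappa_u * (b - a) <= l (q, b, v).
Proof.
move=> ab; have [c _ E] := derivable_MVT (@derivable_u q v) ab.
have /andP[h _] := hu (q, c, v); rewrite /partial_u/= in h.
by have := ler_wpM2r (_ : 0 <= b - a) h; rewrite -E subr_ge0 => /(_ ab); lra.
Qed.

Lemma cost_nonincr q a b a' b' : a <= a' -> b <= b' ->
  l (q, a', b') <= l (q, a, b).
Proof.
move=> aa bb; apply: (@le_trans _ _ (l (q, a, b'))).
  have [c _ E] := derivable_MVT (@derivable_u q b') aa.
  have /andP[_ h] := hu (q, c, b'); rewrite /partial_u/= in h.
  by rewrite -subr_le0 E mulr_le0_ge0// subr_ge0.
have [c _ E] := derivable_MVT (@derivable_v q a) bb.
have /andP[_ h] := hv (q, a, c); rewrite /partial_v/= in h.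
by rewrite -subr_le0 E mulr_le0_ge0// subr_ge0.
Qed.

(** Since [a] and [b] have the same sign, monotonicity squeezes [l] between [l (q, 0, 0)] and
    [l (q, a, b)] on both segments from the origin along the axes, so [l] is constant there, with 0
    as an endpoint. *)
Lemma partials_flat q a b : 0 < a * b -> l (q, a, b) = l (q, 0, 0) ->
  partial_u l (q, 0, 0) + partial_v l (q, 0, 0) = 0.
Proof.
move=> ab0 lab.
have cu : {for 0, continuous ('D_1 (fun u => l (q, u, 0)))}.
  have [_ _ cpu _] := l_C1.
  apply: (@continuous_comp _ _ _ (fun u => (q, u, 0)) (partial_u l)); last exact: cpu.
  by do 2?apply: continuous_pair; [exact: cvg_cst|exact: cvg_id|exact: cvg_cst].
have cv : {for 0, continuous ('D_1 (fun v => l (q, 0, v)))}.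
  have [_ _ _ cpv] := l_C1.
  apply: (@continuous_comp _ _ _ (fun v => (q, 0, v)) (partial_v l)); last exact: cpv.
  by apply: continuous_pair; [exact: cvg_cst|exact: cvg_id].
suff [pu pv] : partial_u l (q, 0, 0) = 0 /\ partial_v l (q, 0, 0) = 0.
  by rewrite pu pv addr0.
have [a0|a0|a0] := ltgtP 0 a; last by rewrite -a0 mul0r ltxx in ab0.
- have b0 : 0 < b by rewrite pmulr_rgt0 in ab0.
  split.
    apply: (derive_flat (@derivable_u q 0) cu a0); first by rewrite lexx ltW.
    move=> y /andP[y0 ya]; apply/eqP; rewrite eq_le cost_nonincr//= -lab.
    by rewrite cost_nonincr// ltW.
  apply: (derive_flat (@derivable_v q 0) cv b0); first by rewrite lexx ltW.
  move=> y /andP[y0 yb]; apply/eqP; rewrite eq_le cost_nonincr//= -lab.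
  by rewrite cost_nonincr// ltW.
- have b0 : b < 0 by rewrite nmulr_rgt0 in ab0.
  split.
    apply: (derive_flat (@derivable_u q 0) cu a0); first by rewrite lexx ltW.
    move=> y /andP[y0 ya]; apply/eqP; rewrite eq_le -{1}lab !cost_nonincr//.
    by rewrite ltW.
  apply: (derive_flat (@derivable_v q 0) cv b0); first by rewrite lexx ltW.
  move=> y /andP[y0 yb]; apply/eqP; rewrite eq_le -{1}lab !cost_nonincr//.
  by rewrite ltW.
Qed.

End cost.

(** * Fixed points take both signs *)

Section sign.
Context {R : realType} {X : pmetricType R}.
Hypothesis compactX : compact [set: X].
Variable l : X * X * R * R -> R.
Hypotheses (l_cont : continuous l) (l_C1 : C1_last_two l).
Variable c0 : R.
Hypothesis hmather : forall mu : borel_probability2 X,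
  mather_measure (fun q => l (q, 0, 0)) c0 mu ->
  (\int[mu]_q (partial_u l (q, 0%R, 0%R) + partial_v l (q, 0%R, 0%R))%:E
     < 0)%E.

Let compactXX : compact [set: X * X].
Proof. by rewrite -setXTT; exact: compact_setX. Qed.

Let diff_cont (w : X -> R) : continuous w ->
  continuous (fun p : X * X => w p.2 - w p.1).
Proof.
move=> cw p; apply: cvgB.
  by apply: continuous_comp; [exact: cvg_snd|exact: cw].
by apply: continuous_comp; [exact: cvg_fst|exact: cw].
Qed.

Let slice_cont (g : X * X * R * R -> R) : continuous g ->
  continuous (fun q : X * X => g (q, 0, 0)).
Proof.
move=> cg q; apply: (@continuous_comp _ _ _ (fun q => (q, 0, 0)) g); last exact: cg.
by do 2?apply: continuous_pair; [exact: cvg_id|exact: cvg_cst|exact: cvg_cst].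
Qed.

(* A closed measure carried by [K] makes the nonnegative function [w p.2 - w
   p.1] integrate to zero, so it is carried by the equality set, where it is
   seen to be a Mather measure violating [hmather]. *)
Lemma no_flat_chain (u0 w : X -> R) (K : set (X * X)) (x : nat -> X) :
  continuous u0 -> continuous w -> closed K -> (forall n, K (x n.+1, x n)) ->
  (forall p, K p -> w p.1 <= w p.2) ->
  (forall p, K p -> w p.1 = w p.2 ->
    u0 p.2 = u0 p.1 + l (p, 0, 0) + c0 /\
    partial_u l (p, 0, 0) + partial_v l (p, 0, 0) = 0) -> False.
Proof.
move=> cu0 cw cK Kx wK Keq.
have [mu [clmu muK]] := exists_closed_measure compactX x.
have {}muK := muK K cK Kx.
pose K' := K `&` [set p | w p.2 - w p.1 = 0].
have cK' : closed K'.
  apply: closedI => //.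
  rewrite (_ : [set p | _] = (fun p : X * X => w p.2 - w p.1) @^-1` [set 0])//.
  by apply: preimage_closed; [move=> p _; exact: diff_cont|exact: closed_eq].
have muK' : mu K' = 1%E.
  apply: (@full_measure_zero R (X * X)%type mu K) => //; first exact: diff_cont.
    by move=> p Kp; rewrite subr_ge0 wK.
  exact: closed_measure_integralB.
have K'eq p : K' p -> u0 p.2 = u0 p.1 + l (p, 0, 0) + c0 /\
    partial_u l (p, 0, 0) + partial_v l (p, 0, 0) = 0.
  by move=> [Kp /= wp]; apply: Keq => //; apply/esym/eqP; rewrite -subr_eq0 wp.
have mather : mather_measure (fun q => l (q, 0, 0)) c0 mu.
  split=> //.
  (* On [K'] the cost is a coboundary of [u0] minus [c0], and the coboundary has zero integral. *)
  rewrite (@full_measure_eq_integral R (X * X)%type mu K' cK' muK' _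
    (fun p => (u0 p.2 - u0 p.1) - c0)).
  - under eq_integral do rewrite EFinB.
    rewrite integralB_EFin//.
    + rewrite closed_measure_integralB// sub0e.
      rewrite (integral_cst mu measurableT c0%:E).
      by rewrite [X in (_ * X)%E]probability_setT mule1.
    + exact: (@continuous_borel_integrable R (X * X)%type mu _ compactXX (diff_cont cu0)).
    + apply: (@continuous_borel_integrable R (X * X)%type mu (cst c0) compactXX).
      by move=> p; exact: cvg_cst.
  - exact: slice_cont.
  - by move=> p; apply: cvgB; [exact: diff_cont|exact: cvg_cst].
  - by move=> p /K'eq[-> _]; lra.
have := hmather mather.
rewrite (@full_measure_eq_integral R (X * X)%type mu K' cK' muK' _ (cst 0)).
- by rewrite (integral_cst mu measurableT 0%:E) mul0e ltxx.
- have [_ _ cpu cpv] := l_C1.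
  by move=> p; apply: cvgD; exact: slice_cont.
- by move=> p; exact: cvg_cst.
- by move=> p /K'eq[].
Qed.

Variables kappa_u kappa_v : R.
Hypothesis hu : forall p, - kappa_u <= partial_u l p <= 0.
Hypothesis hv : forall p, - kappa_v <= partial_v l p <= 0.

Variable u0 : X -> R.
Hypothesis u0_cont : continuous u0.
Hypothesis u0_le : forall z x, u0 x <= u0 z + l (z, x, 0, 0) + c0.
Hypothesis u0_eq : forall x, exists z, u0 x = u0 z + l (z, x, 0, 0) + c0.

Variables (lam : R) (u : X -> R).
Hypothesis lam_gt0 : 0 < lam.
Hypothesis u_cont : continuous u.
Hypothesis u_le : forall z x, u x <= u z + l (z, x, lam * u z, lam * u x) + c0.
Hypothesis u_eq :
  forall x, exists z, u x = u z + l (z, x, lam * u z, lam * u x) + c0.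

Let backward_chain (K : set (X * X)) :
  (forall x, exists z, K (z, x)) -> exists s : nat -> X, forall n, K (s n.+1, s n).
Proof. by move=> /choice[pred predK]; exists (fun n => iter n pred point) => n /=. Qed.

Let cost_cont : continuous (fun p : X * X => l (p, lam * u p.1, lam * u p.2)).
Proof.
move=> p; apply: (@continuous_comp _ _ _
  (fun p : X * X => (p, lam * u p.1, lam * u p.2)) l); last exact: l_cont.
apply: continuous_pair; first apply: continuous_pair; first exact: cvg_id.
- apply: cvgM; first exact: cvg_cst.
  by apply: continuous_comp; [exact: cvg_fst|exact: u_cont].
- apply: cvgM; first exact: cvg_cst.
  by apply: continuous_comp; [exact: cvg_snd|exact: u_cont].
Qed.

(** If [u > 0], the cost along [u] is at most the cost at zero. On pairs calibrated by [u0],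
    subtracting the inequality for [u] makes [u0 - u] nondecreasing from [z] to [x], and equality
    forces the two costs to agree. *)
Lemma exists_nonpositive : exists x, u x <= 0.
Proof.
apply: contrapT => /forallNP u_gt0.
have {}u_gt0 x : 0 < u x by rewrite ltNge; exact/negP.
pose K := [set p : X * X | u0 p.2 - u0 p.1 - l (p, 0, 0) = c0].
have [s Ks] : exists s : nat -> X, forall n, K (s n.+1, s n).
  by apply: backward_chain => x; have [z E] := u0_eq x; exists z; rewrite /K/=; lra.
apply: (@no_flat_chain u0 (fun x => u0 x - u x) K s) => //.
- by move=> x; apply: cvgB; [exact: u0_cont|exact: u_cont].
- rewrite /K (_ : [set p | _] = (fun p => u0 p.2 - u0 p.1 - l (p, 0, 0)) @^-1` [set c0])//.
  apply: preimage_closed; last exact: closed_eq.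
  by move=> p _; apply: cvgB; [exact: diff_cont|exact: slice_cont].
- move=> [z x]; rewrite /K/= => E; have := u_le z x.
  have := cost_nonincr l_C1 hu hv (z, x) (ltW (mulr_gt0 lam_gt0 (u_gt0 z)))
    (ltW (mulr_gt0 lam_gt0 (u_gt0 x))).
  lra.
- move=> [z x]; rewrite /K/= => E wE; split; first lra.
  apply: (partials_flat l_C1 hu hv (a := lam * u z) (b := lam * u x)).
    by rewrite !mulr_gt0.
  have := u_le z x.
  have := cost_nonincr l_C1 hu hv (z, x) (ltW (mulr_gt0 lam_gt0 (u_gt0 z)))
    (ltW (mulr_gt0 lam_gt0 (u_gt0 x))).
  lra.
Qed.

(** Here the pairs are calibrated by [u], and [u < 0] makes the cost along [u] at least the cost at
    zero. Equality of [u - u0] at both ends then yields calibration by [u0] as well, which is what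
    the Mather property requires. *)
Lemma exists_nonnegative : exists x, 0 <= u x.
Proof.
apply: contrapT => /forallNP u_lt0.
have {}u_lt0 x : u x < 0 by rewrite ltNge; exact/negP.
have lu_lt0 x : lam * u x < 0 by rewrite pmulr_rlt0.
pose K := [set p : X * X | u p.2 - u p.1 - l (p, lam * u p.1, lam * u p.2) = c0].
have [s Ks] : exists s : nat -> X, forall n, K (s n.+1, s n).
  apply: backward_chain => x; have [z E] := u_eq x; exists z.
  by rewrite /K/=; lra.
apply: (@no_flat_chain u0 (fun x => u x - u0 x) K s) => //.
- by move=> x; apply: cvgB; [exact: u_cont|exact: u0_cont].
- rewrite /K (_ : [set p | _] =
    (fun p => u p.2 - u p.1 - l (p, lam * u p.1, lam * u p.2)) @^-1` [set c0])//.
  apply: preimage_closed; last exact: closed_eq.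
  by move=> p _; apply: cvgB; [exact: diff_cont|exact: cost_cont].
- move=> [z x]; rewrite /K/= => E; have := u0_le z x.
  have := cost_nonincr l_C1 hu hv (z, x) (ltW (lu_lt0 z)) (ltW (lu_lt0 x)).
  lra.
- move=> [z x]; rewrite /K/= => E wE; have := u0_le z x.
  have := cost_nonincr l_C1 hu hv (z, x) (ltW (lu_lt0 z)) (ltW (lu_lt0 x)).
  move=> h1 h2; split; first lra.
  apply: (partials_flat l_C1 hu hv (a := lam * u z) (b := lam * u x)); last lra.
  by rewrite nmulr_rgt0.
Qed.

End sign.

(** * The implicit Lax-Oleinik operator *)

Section operator.
Context {R : realType} {X : pmetricType R}.
Hypothesis compactX : compact [set: X].
Variable l : X * X * R * R -> R.
Hypotheses (l_cont : continuous l) (l_C1 : C1_last_two l).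
Variables kappa_u kappa_v : R.
Hypothesis hu : forall p, - kappa_u <= partial_u l p <= 0.
Hypothesis hv : forall p, - kappa_v <= partial_v l p <= 0.
Variable c0 : R.

(** The minimum is split into its upper bound and its attainment, for bare functions, so that each
    half can be used alone. *)
Definition lax_oleinik_rel (lam : R) (phi w : X -> R) : Prop :=
  (forall z x, w x <= phi z + l (z, x, lam * phi z, lam * w x) + c0) /\
  (forall x, exists z, w x = phi z + l (z, x, lam * phi z, lam * w x) + c0).

Local Notation rel := lax_oleinik_rel.

Lemma implicit_lax_oleinik_rel lam (T : continuousType X R -> continuousType X R)
    (phi : continuousType X R) :
  is_implicit_lax_oleinik l c0 lam T -> rel lam phi (T phi).
Proof.
move=> hT; split=> [z x|x]; have [m [[z' _ zm] mlb] E] := hT phi x.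
  by rewrite [leLHS]E lerD2r; apply: mlb; exists z.
by exists z'; rewrite [LHS]E -zm.
Qed.

(** For [lam * kappa_u <= 1] the map [s |-> s + l (z, x, lam * s, v)] is nondecreasing. If
    [w x > w' x], a minimizer for [w'] used as a competitor for [w], together with monotonicity in
    the last variable, gives a contradiction. *)
Lemma lax_oleinik_monotone lam phi phi' w w' :
  0 <= lam -> lam * kappa_u <= 1 -> rel lam phi w -> rel lam phi' w' ->
  (forall x, phi x <= phi' x) -> forall x, w x <= w' x.
Proof.
move=> lam0 lk [w_le _] [_ w'_eq] pp x; rewrite leNgt; apply/negP => ww.
have [z E] := w'_eq x.
have h1 := w_le z x.
have h2 : l (z, x, lam * phi' z, lam * w x) <= l (z, x, lam * phi' z, lam * w' x).
  by apply: (cost_nonincr l_C1 hu hv) => //; rewrite ler_wpM2l// ltW.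
have pz := pp z.
have h3 := cost_lipschitz_u l_C1 hu (z, x) (lam * w x) (ler_wpM2l lam0 pz).
have h4 : kappa_u * (lam * phi' z - lam * phi z) <= phi' z - phi z.
  by rewrite -mulrBr mulrA (mulrC kappa_u) ler_piMl// subr_ge0.
lra.
Qed.

(** All arguments of [l] stay in a compact box that depends on [lam0] and [M] but not on [lam], so
    the variation of [l] in its second variable is controlled uniformly. *)
Lemma lax_oleinik_equicontinuous (lam0 M : R) (x : X) (e : R) : 0 < e ->
  \forall y \near x, forall lam phi w, 0 < lam < lam0 -> rel lam phi w ->
    (forall z, `|phi z| <= M) -> (forall z, `|w z| <= M) -> `|w x - w y| <= e.
Proof.
move=> e0.
pose B := lam0 * M.
pose K : set (X * R * R) := (setT `*` `[- B, B]) `*` `[- B, B].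
have cK : compact K.
  apply: compact_setX; last exact: segment_compact.
  by apply: compact_setX => //; exact: segment_compact.
pose P (y : X) (k : X * R * R) :=
  `|l (k.1.1, x, k.1.2, k.2) - l (k.1.1, y, k.1.2, k.2)| < e.
(* Continuity at each [(k, x)] becomes uniform in [k] by compactness of [K]. *)
have : \forall y \near x, K `<=` P y.
  move/compact_near_coveringP : cK; apply => k _.
  pose G (p : (X * R * R) * X) : R :=
    l (p.1.1.1, x, p.1.1.2, p.1.2) - l (p.1.1.1, p.2, p.1.1.2, p.1.2).
  have cG : {for (k, x), continuous G}.
    have c1 : continuous (fun p : (X * R * R) * X => p.1.1.1).
      move=> p; apply: (@continuous_comp _ _ _ fst (fst \o fst)).
        exact: cvg_fst.
      by apply: continuous_comp; exact: cvg_fst.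
    have c2 : continuous (fun p : (X * R * R) * X => p.1.1.2).
      move=> p; apply: (@continuous_comp _ _ _ fst (snd \o fst)).
        exact: cvg_fst.
      by apply: continuous_comp; [exact: cvg_fst|exact: cvg_snd].
    have c3 : continuous (fun p : (X * R * R) * X => p.1.2).
      move=> p; apply: (@continuous_comp _ _ _ fst snd); first exact: cvg_fst.
      exact: cvg_snd.
    apply: cvgB.
      apply: (@continuous_comp _ _ _
        (fun p : (X * R * R) * X => (p.1.1.1, x, p.1.1.2, p.1.2)) l); last exact: l_cont.
      by do 3?apply: continuous_pair; [exact: c1|exact: cvg_cst|exact: c2|exact: c3].
    apply: (@continuous_comp _ _ _
      (fun p : (X * R * R) * X => (p.1.1.1, p.2, p.1.1.2, p.1.2)) l); last exact: l_cont.
    by do 3?apply: continuous_pair; [exact: c1|exact: cvg_snd|exact: c2|exact: c3].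
  have : \forall p \near (k, x), `|G (k, x) - G p| < e.
    by move/cvgrPdist_lt : cG; apply.
  by apply: filterS => -[k' y]; rewrite /G/= subrr sub0r normrN.
apply: filterS => y KP lam phi w /andP[lam_gt0 lam_lt] [w_le w_eq] phiM wM.
have box (v : R) : `|v| <= M -> lam * v \in `[- B, B].
  move=> vM; rewrite in_itv/= -ler_norml normrM gtr0_norm//.
  by rewrite /B ler_pM// ltW.
have KE z v : `|v| <= M -> `|l (z, x, lam * phi z, lam * v) -
    l (z, y, lam * phi z, lam * v)| < e.
  by move=> vM; apply: (KP (z, lam * phi z, lam * v)); split; [split|] => //=; exact: box.
rewrite ler_distl; apply/andP; split.
(* The minimizer at the point with the smaller value competes at the other point; there, lowering
   the implicit argument to the smaller value only raises the cost. *)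
- have [wyx|/ltW wxy] := leP (w y) (w x); first lra.
  have [z E] := w_eq x.
  have := w_le z y; have := KE z (w x) (wM x); rewrite ltr_norml => /andP[h1 h2].
  have : l (z, y, lam * phi z, lam * w y) <= l (z, y, lam * phi z, lam * w x).
    by apply: (cost_nonincr l_C1 hu hv) => //; rewrite ler_pM2l.
  lra.
- have [wxy|/ltW wyx] := leP (w x) (w y); first lra.
  have [z E] := w_eq y.
  have := w_le z x; have := KE z (w y) (wM y); rewrite ltr_norml => /andP[h1 h2].
  have : l (z, x, lam * phi z, lam * w x) <= l (z, x, lam * phi z, lam * w y).
    by apply: (cost_nonincr l_C1 hu hv) => //; rewrite ler_pM2l.
  lra.
Qed.

(** For [u z <= 0 <= u y], raising the last argument of the bound for [u y] to 0 is harmless, since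
    [l] is nonincreasing and [lam * u y >= 0], and moving [lam * u z] to 0 costs at most
    [lam * kappa_u * |u z|]. Hence [u y + (1 - lam * kappa_u) * |u z| <= C], which bounds both
    signs. *)
Lemma fixed_point_bound (lam0 lam C : R) (u : X -> R) :
  (forall q, `|l (q, 0, 0) + c0| <= C) -> 0 < lam < lam0 -> 0 <= kappa_u ->
  lam0 * kappa_u < 1 -> rel lam u u -> (exists x, u x <= 0) ->
  (exists x, 0 <= u x) -> forall x, `|u x| <= C / (1 - lam0 * kappa_u).
Proof.
move=> lC /andP[lam_gt0 lam_lt] k0 lk [u_le _] [xn uxn] [xp uxp] x.
have D0 : 0 < 1 - lam0 * kappa_u by rewrite subr_gt0.
have lkk : lam * kappa_u <= lam0 * kappa_u by rewrite ler_wpM2r// ltW.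
have lkge0 : 0 <= lam * kappa_u by rewrite mulr_ge0// ltW.
have C0 : 0 <= C by apply: le_trans (lC (xn, xp)).
rewrite ler_pdivlMr//.
have key z y : u z <= 0 -> 0 <= u y ->
    u y <= u z - lam * kappa_u * u z + C.
  move=> uz uy; have h1 := u_le z y.
  have lz : lam * u z <= 0 by rewrite pmulr_rle0.
  have ly : 0 <= lam * u y by rewrite pmulr_rge0.
  have h2 := cost_nonincr l_C1 hu hv (z, y) (lexx (lam * u z)) ly.
  have h3 := cost_lipschitz_u l_C1 hu (z, y) 0 lz.
  have := lC (z, y); rewrite ler_norml => /andP[_ h4].
  have -> : lam * kappa_u * u z = kappa_u * (lam * u z) by rewrite mulrCA mulrA.
  lra.
have [ux|/ltW ux] := leP 0 (u x).
  have h := key xn x uxn ux.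
  rewrite ger0_norm//; nra.
have h := key x xp ux uxp.
rewrite ler0_norm//; nra.
Qed.

End operator.

(** * Existence of fixed points by monotone iteration *)

Lemma continuous_bounded (R : realType) (Y : topologicalType) (f : Y -> R) :
  compact [set: Y] -> continuous f -> exists M : R, forall y, `|f y| <= M.
Proof.
move=> cY cf.
have /compact_bounded [M [_ h]] : compact (f @` setT).
  by apply: continuous_compact => //; exact: continuous_subspaceT.
exists (`|M| + 1) => y; apply: (h (`|M| + 1)); last by exists y.
by rewrite (le_lt_trans (ler_norm M))// ltrDl.
Qed.

Section fixed_point.
Context {R : realType} {X : pmetricType R}.
Hypothesis compactX : compact [set: X].
Variable l : X * X * R * R -> R.
Hypotheses (l_cont : continuous l) (l_C1 : C1_last_two l).
Variables kappa_u kappa_v : R.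
Hypothesis hu : forall p, - kappa_u <= partial_u l p <= 0.
Hypothesis hv : forall p, - kappa_v <= partial_v l p <= 0.
Variable c0 : R.

Local Notation rel := (lax_oleinik_rel l c0).

(** If [w x > u0 x + B] then [w x] is nonnegative too, so both arguments of the cost are nonnegative
    and it is at most the cost at zero; the critical equation at a minimizer of [u0] contradicts the
    assumption. *)
Lemma supersolution lam u0 (B : R) w : 0 < lam -> (forall x, - B <= u0 x) ->
  (forall x, exists z, u0 x = u0 z + l (z, x, 0, 0) + c0) ->
  rel lam (fun x => u0 x + B) w -> forall x, w x <= u0 x + B.
Proof.
move=> lam_gt0 uB u0_eq [w_le _] x; rewrite leNgt; apply/negP => wx.
have [z E] := u0_eq x; have := w_le z x.
have u0z : 0 <= lam * (u0 z + B) by rewrite pmulr_rge0//; have := uB z; lra.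
have wx0 : 0 <= lam * w x by rewrite pmulr_rge0//; have := uB x; lra.
have := cost_nonincr l_C1 hu hv (z, x) u0z wx0.
lra.
Qed.

Lemma subsolution lam u0 (B : R) w : 0 < lam -> (forall x, u0 x <= B) ->
  (forall z x, u0 x <= u0 z + l (z, x, 0, 0) + c0) ->
  rel lam (fun x => u0 x - B) w -> forall x, u0 x - B <= w x.
Proof.
move=> lam_gt0 uB u0_le [_ w_eq] x; rewrite leNgt; apply/negP => wx.
have [z E] := w_eq x; have := u0_le z x.
have u0z : lam * (u0 z - B) <= 0 by rewrite pmulr_rle0//; have := uB z; lra.
have wx0 : lam * w x <= 0 by rewrite pmulr_rle0//; have := uB x; lra.
have := cost_nonincr l_C1 hu hv (z, x) u0z wx0.
lra.
Qed.

Variables (lam : R) (T : continuousType X R -> continuousType X R).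
Hypotheses (lam_gt0 : 0 < lam) (lamk : lam * kappa_u <= 1).
Hypothesis hT : is_implicit_lax_oleinik l c0 lam T.

Let T_mono (phi psi : continuousType X R) :
  (forall x, phi x <= psi x) -> forall x, T phi x <= T psi x.
Proof.
apply: (lax_oleinik_monotone l_C1 hu hv (ltW lam_gt0) lamk);
  exact: implicit_lax_oleinik_rel.
Qed.

(* The iterates of a supersolution decrease; equicontinuity makes their limit
   continuous, and pointwise convergence suffices to pass to the limit in the
   implicit equation. *)
Lemma exists_fixed_point (psi phi : continuousType X R) :
  (forall x, T psi x <= psi x) -> (forall x, phi x <= T phi x) ->
  (forall x, phi x <= psi x) -> exists w, fixed_points T w.
Proof.
move=> Tpsi Tphi phipsi.
pose s n : continuousType X R := iter n T psi.
have s_decr n x : s n.+1 x <= s n x.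
  by elim: n x => [|n IH] x; [exact: Tpsi|exact: T_mono].
have s_ge n x : phi x <= s n x.
  elim: n x => [|n IH] x; first exact: phipsi.
  by apply: (le_trans (Tphi x)); exact: T_mono.
have s_le n x : s n x <= psi x.
  by elim: n => [|n IH]; [exact: lexx|exact: le_trans (s_decr n x) IH].
have s_noninc x : nonincreasing_seq (fun n => s n x).
  by apply/nonincreasing_seqP => n; exact: s_decr.
have s_cvg x : cvgn (fun n => s n x).
  apply: nonincreasing_is_cvgn => //.
  by exists (phi x) => _ [n _ <-]; exact: s_ge.
pose w x : R := limn (fun n => s n x).
have s_w x : (fun n => s n x) @ \oo --> w x by exact: s_cvg.
have s_wS x : (fun n => s n.+1 x) @ \oo --> w x.
  by rewrite (cvg_shiftS (fun n => s n x)).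
have [M1 M1P] := continuous_bounded compactX (@cts_fun _ _ phi).
have [M2 M2P] := continuous_bounded compactX (@cts_fun _ _ psi).
have sM n x : `|s n x| <= M1 + M2.
  have := s_ge n x; have := s_le n x; have := M1P x; have := M2P x.
  by rewrite !ler_norml => /andP[? ?] /andP[? ?] ? ?; apply/andP; split; lra.
have cw : continuous w.
  move=> x; apply/cvgrPdist_le => e e0.
  (* All iterates share the same [lam], so any strict upper bound for it serves. *)
  have := lax_oleinik_equicontinuous compactX l_cont l_C1 hu hv c0 (lam + 1) (M1 + M2) x e0.
  apply: filterS => y h.
  have /cvg_norm h1 : (fun n => s n.+1 x - s n.+1 y) @ \oo --> w x - w y.
    by apply: cvgB; exact: s_wS.
  apply: (cvgr_to_le h1); apply: nearW => n.
  apply: (h lam (s n) (s n.+1)) => //; first by rewrite lam_gt0 ltrDl ltr01.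
  exact: implicit_lax_oleinik_rel.
pose W : continuousType X R := HB.pack w (@isContinuous.Build _ _ w cw).
(* Only the inequality half passes to the limit, so the minimizers of the iterates need not be
   followed. *)
have w_le z x : w x <= w z + l (z, x, lam * w z, lam * w x) + c0.
  apply: (ler_cvg_to (s_wS x) (g := fun n => s n z +
    l (z, x, lam * s n z, lam * s n.+1 x) + c0)); last first.
    by apply: nearW => n; have [+ _] := implicit_lax_oleinik_rel (s n) hT; exact.
  apply: cvgD; last exact: cvg_cst.
  apply: cvgD; first exact: s_w.
  apply: (cvg_comp (fun n => (z, x, lam * s n z, lam * s n.+1 x)) l); last exact: l_cont.
  apply: cvg_to_pair; first apply: cvg_to_pair; first exact: cvg_cst.
  - by apply: cvgM; [exact: cvg_cst|exact: s_w].
  - by apply: cvgM; [exact: cvg_cst|exact: s_wS].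
exists W; apply/continuousEP => x; apply/eqP; rewrite eq_le; apply/andP; split.
  apply: (cvgr_to_ge (s_wS x)); apply: nearW => n.
  by apply: T_mono => y; exact: nonincreasing_cvgn_ge.
(* A minimizer for [T W x] is inserted into [w_le]; if [T W x < w x], monotonicity in the last
   variable makes the two bounds incompatible. *)
rewrite leNgt; apply/negP => wx.
have [_ /(_ x) [z E]] := implicit_lax_oleinik_rel W hT.
have := w_le z x.
have : l (z, x, lam * w z, lam * w x) <= l (z, x, lam * w z, lam * T W x).
  by apply: (cost_nonincr l_C1 hu hv) => //; rewrite ler_pM2l// ltW.
move: E wx; rewrite /W/=; lra.
Qed.

End fixed_point.

(** * Existence and uniform estimates for all discount parameters *)

Theorem theorem1 (R : realType) (X : pmetricType R)
    (compactX : compact [set: X])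
    (l : X * X * R * R -> R) (l_cont : continuous l) (l_C1 : C1_last_two l)
    (kappa_u : R) (kappa_u_gt0 : 0 < kappa_u)
    (hu : forall p, - kappa_u <= partial_u l p <= 0)
    (kappa_v : R) (kappa_v_gt0 : 0 < kappa_v)
    (hv : forall p, - kappa_v <= partial_v l p <= 0)
    (c0 : R) (hc0 : is_critical_constant (fun q => l (q, 0, 0)) c0)
    (hmather : forall mu : borel_probability2 X,
       mather_measure (fun q => l (q, 0, 0)) c0 mu ->
       (\int[mu]_q (partial_u l (q, 0%R, 0%R) + partial_v l (q, 0%R, 0%R))%:E
          < 0)%E)
    (lam0 : R) (lam0_gt0 : 0 < lam0)
    (hlam0 : lam0 * Num.max kappa_u kappa_v < 1)
    (T : R -> continuousType X R -> continuousType X R)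
    (hT : forall lam : R, 0 < lam < lam0 ->
       is_implicit_lax_oleinik l c0 lam (T lam)) :
  (forall lam : R, 0 < lam < lam0 -> exists u_lam, fixed_points (T lam) u_lam) /\
  let F := \bigcup_(lam in `]0, lam0[) fixed_points (T lam) in
  equicontinuous F (fun u : continuousType X R => u : X -> R) /\
  exists M : R, forall u, F u -> forall x, `|u x| <= M.
Proof.
have [kappa_u_ge0 k1] : 0 <= kappa_u /\ lam0 * kappa_u < 1.
  split; first exact: ltW.
  by apply: le_lt_trans hlam0; rewrite ler_pM2l// le_max lexx.
have [u0 hu0] := hc0.
have u0_le z x : u0 x <= u0 z + l (z, x, 0, 0) + c0.
  have [m [_ mlb] ->] := hu0 x.
  by rewrite lerD2r; apply: mlb; exists z.
have u0_eq x : exists z, u0 x = u0 z + l (z, x, 0, 0) + c0.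
  by have [m [[z _ <-] _] ->] := hu0 x; exists z.
have lam_k lam : 0 < lam < lam0 -> lam * kappa_u <= 1.
  move=> /andP[_ /ltW lamlt]; apply: le_trans (ltW k1).
  by rewrite ler_wpM2r.
split.
  move=> lam lamP; have /andP[lam_gt0 _] := lamP.
  have [B BP] := continuous_bounded compactX (@cts_fun _ _ u0).
  have cst_cont (b : R) : continuous (fun x => u0 x + b).
    by move=> x; apply: cvgD; [exact: cts_fun|exact: cvg_cst].
  pose shift (b : R) : continuousType X R :=
    HB.pack (fun x => u0 x + b) (@isContinuous.Build _ _ _ (cst_cont b)).
  apply: (exists_fixed_point compactX l_cont l_C1 hu hv lam_gt0 (lam_k _ lamP)
    (hT _ lamP) (psi := shift B) (phi := shift (- B))).
  - apply: (supersolution l_C1 hu hv lam_gt0 _ u0_eq).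
      by move=> x; have := BP x; rewrite ler_norml => /andP[].
    exact: (implicit_lax_oleinik_rel (shift B) (hT _ lamP)).
  - apply: (subsolution l_C1 hu hv lam_gt0 _ u0_le).
      by move=> x; have := BP x; rewrite ler_norml => /andP[].
    exact: (implicit_lax_oleinik_rel (shift (- B)) (hT _ lamP)).
  - by move=> x; have := BP x; rewrite /= lerD2l ler_norml => /andP[]; lra.
have [C CP] : exists C : R, forall q, `|l (q, 0, 0) + c0| <= C.
  apply: continuous_bounded.
    by rewrite -setXTT; exact: compact_setX.
  move=> q; apply: cvgD; last exact: cvg_cst.
  apply: (@continuous_comp _ _ _ (fun q => (q, 0, 0)) l); last exact: l_cont.
  by do 2?apply: continuous_pair; [exact: cvg_id|exact: cvg_cst|exact: cvg_cst].
pose M := C / (1 - lam0 * kappa_u).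
have relF lam u : 0 < lam < lam0 -> fixed_points (T lam) u ->
    lax_oleinik_rel l c0 lam u u.
  by move=> lamP uT; have := implicit_lax_oleinik_rel u (hT _ lamP); rewrite uT.
have bound lam u : 0 < lam < lam0 -> fixed_points (T lam) u ->
    forall x, `|u x| <= M.
  move=> lamP uT; have [u_le u_eq] := relF _ _ lamP uT.
  have /andP[lam_gt0 _] := lamP.
  apply: (fixed_point_bound l_C1 hu hv CP lamP) => //.
  - exact: (exists_nonpositive compactX l_cont l_C1 hmather hu hv
      (@cts_fun _ _ u0) u0_eq lam_gt0 (@cts_fun _ _ u) u_le).
  - exact: (exists_nonnegative compactX l_cont l_C1 hmather hu hv
      (@cts_fun _ _ u0) u0_le lam_gt0 (@cts_fun _ _ u) u_eq).
split; last first.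
  by exists M => u [lam]; rewrite /= in_itv/= => lamP uT x; exact: bound uT x.
move=> x E /=; rewrite -entourage_ballE => -[e /= e0 eE].
have e2 : 0 < e / 2 by rewrite divr_gt0.
have := lax_oleinik_equicontinuous compactX l_cont l_C1 hu hv c0 lam0 M x e2.
apply: filterS => y h u [lam]; rewrite /= in_itv/= => lamP uT.
apply: eE; rewrite /ball/=.
(* The modulus gives a non-strict bound, so half of [e] is used to land in the open ball. *)
apply: (@le_lt_trans _ _ (e / 2)); last by rewrite ltr_pdivrMr// ltr_pMr// ltr1n.
by apply: (h lam u u lamP (relF _ _ lamP uT)) => z; exact: bound uT z.
Qed.
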